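(* Let $N, M$ be positive integers and let $a_{1},\ldots,a_{N}$ be positive integers (not necessarily distinct) with $a_{n}\leq M$ for all $1\leq n\leq N$. For $d\in\mathbb{N}$ set $\omega(d)=\#\{n\leq N:\ a_{n}\equiv 0 \pmod d\}$. Let $\alpha\in(0,1]$, $y=\max\big((\ln M)^{\alpha},2\big)$, and let $\mathcal{D}$ be the set of square-free positive integers all of whose prime divisors lie in $(1,y]$ (so $1\in\mathcal{D}$). Let $\gamma>0$, $c_{0}>0$, and let $g$ be a multiplicative function such that \[ \omega(n)\leq \frac{\gamma N}{g(n)}\quad\text{for every } n\in\mathcal{D}, \] $g(p)\geq c_{0}$ for every prime $p$, and \[ L=\sum_{p}\frac{1}{p\,g(p)}<\infty . \] Then there are positive constants $C$, $c_{1}$, $c_{2}$ depending only on $\gamma$, $L$, $c_{0}$ and $\alpha$ such that \[ \sum_{n=1}^{N}\Big(\frac{a_{n}}{\varphi(a_{n})}\Big)^{s}\leq \exp\big(s\log\log(s+2)+Cs\big)\,N\quad\text{for every } s\in\mathbb{N}, \] and \[ \#\Big\{n\leq N:\ \frac{a_{n}}{\varphi(a_{n})}>t\Big\}\leq c_{1}\exp\big(-\exp(c_{2}t)\big)\,N\quad\text{for every } t>0. \]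
   Context: $\varphi$ denotes Euler's totient function; $p$ always denotes a prime and sums/products over $p$ run over primes; $\ln$ and $\log$ denote the natural logarithm. *)

(* Defs.v *)
From mathcomp Require Import all_boot all_order all_algebra.
From mathcomp Require Import all_classical all_reals all_analysis.

Set Implicit Arguments.
Unset Strict Implicit.
Unset Printing Implicit Defensive.

Import Order.TTheory GRing.Theory Num.Theory.
Import numFieldNormedType.Exports.

Local Open Scope ring_scope.

(* Only the values on positive integers matter; [g 0] is unconstrained. *)
Definition multiplicative_function (R : realType) (g : nat -> R) : Prop :=
  g 1%N = 1 /\
  forall m n : nat, (0 < m)%N -> (0 < n)%N -> coprime m n ->
    g (m * n)%N = g m * g n.

Definition square_free (n : nat) : Prop :=
  (0 < n)%N /\ forall d : nat, (d ^ 2 %| n)%N -> d = 1%N.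

Definition omega (N : nat) (a : 'I_N -> nat) (d : nat) : nat :=
  #|[set n : 'I_N | (d %| a n)%N]|.

(* For M = 1 the power is 0 `^ alpha = 0 (alpha > 0), so the level is 2. *)
Definition sieve_level (R : realType) (M : nat) (alpha : R) : R :=
  Num.max ((ln M%:R) `^ alpha) 2.

Definition sieve_support (R : realType) (y : R) (n : nat) : Prop :=
  square_free n /\
  forall p : nat, prime p -> (p %| n)%N -> 1 < p%:R :> R /\ p%:R <= y.

Definition totient_ratio (R : realType) (n : nat) : R :=
  n%:R / (totient n)%:R.

(* Main.v *)
Require Import Defs.
From mathcomp Require Import all_boot all_order all_algebra.
From mathcomp Require Import all_classical all_reals all_analysis.
From mathcomp Require Import zify ring lra.

(* Write [a / phi(a)] as the product of [p / (p - 1)] over the primes [p] dividing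
   [a].  The primes above the level [y = (ln M) ^ alpha] contribute a bounded
   factor.  The [s]-th power of the rest is a product of factors
   [1 + f(p) 1_(p | a)] with [f(p) = (p / (p - 1)) ^ s - 1]; expanding it and using
   [omega(d) <= gamma N / g(d)], the moment is at most
   [gamma N \prod_(p <= y) (1 + f(p) / g(p))].  For [p > s] the factor is
   [exp(O(s / (p g(p))))], which costs [exp(O(L s))] in total; for [p <= s] it is at
   most [exp(1 / c0 + s / (p - 1))], and Mertens' upper bound
   [\sum_(p <= s) 1 / p <= ln (ln s) + O(1)], with its sharp leading constant, gives
   the first claim.  The tail estimate follows by Markov's inequality with
   [s] about [exp(c2 t)]. *)

Set Implicit Arguments.
Unset Strict Implicit.
Unset Printing Implicit Defensive.

Import Order.TTheory GRing.Theory Num.Theory.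
Import numFieldNormedType.Exports.

Local Open Scope ring_scope.

(** * Chebyshev's bound on the product of the primes up to [n] *)

Lemma prime_dvd_fact (p n : nat) : prime p -> (p %| n`!)%N = (p <= n)%N.
Proof.
move=> pp; apply/idP/idP => [|le_pn]; last by rewrite dvdn_fact ?prime_gt0.
elim: n => [|n IHn]; first by rewrite fact0 dvdn1 => /eqP p1; rewrite p1 in pp.
rewrite factS Euclid_dvdM // => /orP[/dvdn_leq -> //|/IHn]; exact: leqW.
Qed.

Lemma prod_primes_dvd (s : seq nat) (m : nat) :
  uniq s -> {in s, forall p, prime p && (p %| m)%N} ->
  (\prod_(p <- s) p %| m)%N.
Proof.
elim: s => [|q s IHs] /=; first by rewrite big_nil dvd1n.
move=> /andP[q_s us] sP; rewrite big_cons.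
have /andP[pq q_m] := sP q (mem_head _ _).
have sP' : {in s, forall p, prime p && (p %| m)%N}.
  by move=> p ps; apply: sP; rewrite inE ps orbT.
rewrite Gauss_dvd ?q_m ?IHs // prime_coprime // Euclid_dvd_prod // big_has.
apply/hasPn => p ps; apply: contra q_s => q_p.
have /andP[pp _] := sP' p ps.
by move: q_p; rewrite dvdn_prime2 // => /eqP ->.
Qed.

(** The coefficients at [m] and [m.+1] are equal, and both occur in the expansion of
    [(1 + 1) ^ m.*2.+1]. *)
Lemma leq_bin_odd (m : nat) : ('C(m.*2.+1, m) <= 4 ^ m)%N.
Proof.
have : (\sum_(m <= i < m.+2) 'C(m.*2.+1, i) <= 2 ^ m.*2.+1)%N.
  rewrite -[2%N]/(1 + 1)%N expnDn.
  under [X in (_ <= X)%N]eq_bigr do rewrite !exp1n !muln1.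
  rewrite -(big_mkord xpredT (fun i => 'C(m.*2.+1, i))).
  rewrite [X in (_ <= X)%N](@big_cat_nat _ _ _ m) /= ?(leqW, leqnSn) //; last by lia.
  rewrite [X in (_ + X)%N](@big_cat_nat _ _ _ m.+2) /=; lia.
rewrite big_nat_recl // big_nat1.
have <- : 'C(m.*2.+1, m) = 'C(m.*2.+1, m.+1).
  by rewrite -bin_sub; [congr 'C(_, _); lia | lia].
rewrite expnS; have -> : (2 ^ m.*2 = 4 ^ m)%N by rewrite -mul2n expnM.
move=> le2; rewrite -(leq_pmul2l (isT : 0 < 2)%N) mul2n -addnn; exact: le2.
Qed.

(** Erdos's induction: an even [n > 2] adds no prime; for [n = m.*2.+1] the induction hypothesis
    covers the primes up to [m.+1], and the product of the larger ones divides ['C(m.*2.+1, m)]. *)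
Lemma leq_primorial (n : nat) :
  (\prod_(0 <= p < n.+1 | prime p) p <= 4 ^ n)%N.
Proof.
elim/ltn_ind: n => n IHn.
have [n2|n2] := leqP n 2.
  by case: n n2 IHn => [|[|[|//]]] _ _; rewrite unlock.
have [odd_n|en] := boolP (odd n); last first.
  rewrite big_mkcond big_nat_recr //= -big_mkcond.
  have /negPf-> : ~~ prime n.
    apply/negP => /even_prime[n_2|on]; first by rewrite n_2 in n2.
    by rewrite on in en.
  rewrite muln1; case: n n2 en IHn => // n n2 en /(_ n (leqnn _)) /leq_trans -> //.
  by rewrite leq_exp2l.
have [m nE] : exists m, n = m.*2.+1.
  by exists n./2; rewrite -[LHS]odd_double_half odd_n.
have m0 : (0 < m)%N by lia.
rewrite {}nE in n2 odd_n IHn *.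
rewrite (@big_cat_nat _ _ _ m.+2) /=; [|by []|by rewrite !ltnS; lia].
have -> : (4 ^ m.*2.+1 = 4 ^ m.+1 * 4 ^ m)%N by rewrite -expnD; congr (_ ^ _)%N; lia.
apply: leq_mul; first by apply: IHn; lia.
apply: leq_trans (leq_bin_odd m); apply: dvdn_leq; first by rewrite bin_gt0; lia.
rewrite -big_filter; apply: prod_primes_dvd.
  by rewrite filter_uniq // iota_uniq.
move=> p; rewrite mem_filter mem_index_iota => /andP[pp /andP[lep ltp]].
rewrite pp /=; have le_m : (m <= m.*2.+1)%N by lia.
(* Such a [p] divides (2m+1)! but neither m! nor (m+1)!, so it divides their binomial quotient. *)
have : (p %| (m.*2.+1)`!)%N by rewrite prime_dvd_fact.
rewrite -(bin_fact le_m) !Euclid_dvdM // !prime_dvd_fact //; lia.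
Qed.

(** * Mertens' upper bounds for sums over primes *)

Lemma sum_ln_nat (R : realType) (s : seq nat) :
  {in s, forall i, (0 < i)%N} ->
  \sum_(i <- s) ln i%:R = ln (\prod_(i <- s) i)%N%:R :> R.
Proof.
elim: s => [|i s IHs] sP; first by rewrite !big_nil ln1.
have i0 : (0 < i)%N by apply: sP; rewrite mem_head.
have sP' : {in s, forall i, (0 < i)%N} by move=> j js; apply: sP; rewrite inE js orbT.
rewrite !big_cons natrM lnM ?IHs // posrE ltr0n //.
rewrite big_seq_cond prodn_cond_gt0 // => j; rewrite andbT; exact: sP'.
Qed.

Lemma ler_ln_nat (R : realType) (m n : nat) :
  (0 < m)%N -> (m <= n)%N -> ln m%:R <= ln n%:R :> R.
Proof.
by move=> m0 mn; rewrite ler_ln ?ler_nat // posrE ltr0n // (leq_trans m0).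
Qed.

Lemma sum_ln_primes_le (R : realType) (s : seq nat) (m : nat) :
  (0 < m)%N -> uniq s -> {in s, forall p, prime p && (p %| m)%N} ->
  \sum_(p <- s) ln p%:R <= ln m%:R :> R.
Proof.
move=> m0 us sP; rewrite sum_ln_nat => [|p /sP/andP[/prime_gt0]//].
apply: ler_ln_nat; last exact: dvdn_leq m0 (prod_primes_dvd us sP).
rewrite big_seq_cond prodn_cond_gt0 // => p; rewrite andbT.
by move=> /sP/andP[/prime_gt0].
Qed.

Lemma sum_ln_primes_upto (R : realType) (n : nat) :
  \sum_(0 <= p < n.+1 | prime p) ln p%:R <= n%:R * ln 4 :> R.
Proof.
rewrite -big_filter sum_ln_nat; last first.
  by move=> p; rewrite mem_filter => /andP[/prime_gt0].
rewrite big_filter mulr_natl -lnXn // -natrX ler_ln_nat ?leq_primorial //.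
by rewrite prodn_cond_gt0 // => p /prime_gt0.
Qed.

(* Compare two evaluations of [ln n!]: [n ln n] from above, and
   [\sum_p (n %/ p) ln p] from below. *)
Lemma sum_ln_primes_div_le (R : realType) (n : nat) : (0 < n)%N ->
  \sum_(0 <= p < n.+1 | prime p) ln p%:R / p%:R <= ln n%:R + ln 4 :> R.
Proof.
move=> n0; have n0' : 0 < n%:R :> R by rewrite ltr0n.
rewrite -(ler_pM2l n0') mulrDr mulr_sumr.
(* Rounding [n / p] down loses less than 1; the lost terms [ln p] add up to at most [n ln 4] by
   Chebyshev's bound. *)
have /le_trans-> // : \sum_(0 <= p < n.+1 | prime p) n%:R * (ln p%:R / p%:R)
    <= \sum_(0 <= p < n.+1 | prime p) (ln p%:R * (n %/ p)%:R + ln p%:R) :> R.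
  apply: ler_sum => p pp; have p0 : 0 < p%:R :> R by rewrite ltr0n prime_gt0.
  rewrite mulrCA -[X in _ + X]mulr1 -mulrDr ler_wpM2l ?ln_ge0 ?ler1n ?prime_gt0 //.
  rewrite ler_pdivrMr // natr1 -natrM ler_nat ltnW // ltn_ceil // prime_gt0 //.
rewrite big_split /= lerD ?sum_ln_primes_upto //.
apply: (@le_trans _ _ (\sum_(1 <= m < n.+1) ln m%:R)); last first.
  rewrite mulr_natl -[X in _ *+ X](subn1 n.+1) -sumr_const_nat.
  rewrite big_nat [leRHS]big_nat.
  by apply: ler_sum => m /andP[m0 mn]; apply: ler_ln_nat.
(* [n %/ p] counts the multiples [m] of [p] up to [n]; after the exchange, the primes dividing [m]
   contribute at most [ln m]. *)
under eq_bigr do rewrite divn_count_dvd natr_sum mulr_sumr.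
rewrite exchange_big /= big_nat [leRHS]big_nat.
apply: ler_sum => m /andP[m0 mn].
under eq_bigr do rewrite mulr_natr mulrb.
rewrite -big_mkcondr -big_filter; apply: sum_ln_primes_le => //.
  by rewrite filter_uniq // iota_uniq.
by move=> p; rewrite mem_filter => /andP[].
Qed.

(** Partial summation with weight [1 / ln k]. The integral of the continuous argument is replaced by
    comparing increments of [1 / ln] with those of [ln ln], which keeps the leading constant 1. *)
Lemma abel_sum_div_ln (R : realType) (b : nat -> R) (c : R) :
  b 0%N = 0 -> b 1%N = 0 ->
  (forall n, (0 < n)%N -> \sum_(0 <= k < n.+1) b k <= ln n%:R + c) ->
  forall n, (0 < n)%N ->
  \sum_(0 <= k < n.+1) b k / ln k%:R <=
    ln (ln n.+1%:R) + (1 - ln (ln 2) + c / ln 2).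
Proof.
move=> b0 b1 bA.
have ln_gt0' k : (0 < k)%N -> 0 < ln k.+1%:R :> R by move=> k0; rewrite ln_gt0 // ltr1n.
(* The induction keeps the boundary term, with its weight taken at [n.+1]; at [n = 1] both sides
   vanish. *)
suff main n : (0 < n)%N -> \sum_(0 <= k < n.+1) b k / ln k%:R <=
    (\sum_(0 <= k < n.+1) b k) / ln n.+1%:R + ln (ln n.+1%:R) - ln (ln 2)
    + c / ln 2 - c / ln n.+1%:R.
  move=> n n0; apply: le_trans (main n n0) _.
  have : (\sum_(0 <= k < n.+1) b k) / ln n.+1%:R <= 1 + c / ln n.+1%:R.
    rewrite ler_pdivrMr ?ln_gt0' // mulrDl mul1r divfK ?gt_eqF ?ln_gt0' //.
    by apply: le_trans (bA n n0) _; rewrite lerD2r ler_ln_nat.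
  lra.
elim: n => // -[|n] IHn _.
  by rewrite !big_nat_recr //= !big_nil b0 b1 !mul0r !addr0 mul0r; lra.
have {IHn}IHn := IHn isT.
rewrite big_nat_recr //= [in leRHS]big_nat_recr //=.
have := bA n.+2 isT; rewrite big_nat_recr //=.
set A := \sum_(0 <= k < n.+2) b k in IHn *; set x := b n.+2.
have u0 := ln_gt0' n.+1 isT; have v0 := ln_gt0' n.+2 isT.
set u := ln n.+2%:R in IHn u0 *; set v := ln n.+3%:R in v0 *.
have uv : u <= v by apply: ler_ln_nat.
move=> hA; set S := \sum_(0 <= _ < _) _ in IHn *.
(* Changing the weight from [u^-1] to [v^-1] costs at most [1 - u / v + c (u^-1 - v^-1)]. The first
   part is absorbed by [ln v - ln u], the second by the change in the final term of [main]. *)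
have step : (A + x) * (u^-1 - v^-1) <= (u + c) * (u^-1 - v^-1).
  by rewrite ler_wpM2r // subr_ge0 lef_pV2.
have lnuv : 1 - u / v <= ln v - ln u.
  have := @le_ln1Dx R (u / v - 1).
  have uv0 : 0 < u / v by rewrite divr_gt0.
  rewrite (addrC 1) subrK ln_div ?posrE // => /(_ _); lra.
have uu : u * u^-1 = 1 by rewrite divff // gt_eqF.
lra.
Qed.

Lemma sum_inv_primes_le (R : realType) (n : nat) : (0 < n)%N ->
  \sum_(0 <= p < n.+1 | prime p) p%:R^-1 <=
    ln (ln n.+1%:R) + (1 - ln (ln 2) + ln 4 / ln 2) :> R.
Proof.
move=> n0; pose b p : R := if prime p then ln p%:R / p%:R else 0.
have bA k : (0 < k)%N -> \sum_(0 <= p < k.+1) b p <= ln k%:R + ln 4.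
  by move=> k0; rewrite -big_mkcond sum_ln_primes_div_le.
apply: le_trans (abel_sum_div_ln _ _ bA n0) => //.
rewrite big_mkcond ler_sum // => p _; rewrite /b; case: ifP => [pp|]; last by rewrite mul0r.
by rewrite mulrAC divff ?mul1r // gt_eqF // ln_gt0 // ltr1n prime_gt1.
Qed.

Lemma sum_inv_pred_primes_le (R : realType) (n : nat) : (0 < n)%N ->
  \sum_(0 <= p < n.+1 | prime p) p.-1%:R^-1 <=
    ln (ln n.+1%:R) + (2 - ln (ln 2) + ln 4 / ln 2) :> R.
Proof.
move=> n0; have -> : (2 : R) = 1 + 1 by [].
suff h : \sum_(0 <= p < n.+1 | prime p) (p.-1%:R^-1 - p%:R^-1) <= 1 :> R.
  have := sum_inv_primes_le R n0; move: h; rewrite sumrB; lra.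
(* From 2 on the differences are nonnegative and telescope, so primality may be dropped. The index 1
   is left out: as [0^-1 = 0], its difference is [-1]. *)
apply: (@le_trans _ _ (\sum_(2 <= p < n.+1) (p.-1%:R^-1 - p%:R^-1))).
  case: n n0 => // n _.
  rewrite [leLHS]big_mkcond 2?big_nat_recl //= -/(index_iota 0 n) !add0r.
  rewrite -[2%N]/(0 + 2)%N big_addn subn2 /= big_nat [leRHS]big_nat.
  apply: ler_sum => p _; rewrite addn2; case: ifP => // _.
  by rewrite subr_ge0 lef_pV2 ?posrE ?ltr0n // ler_nat.
case: n n0 => // n _; rewrite big_add1 /=.
have -> : \sum_(1 <= p < n.+1) (p%:R^-1 - p.+1%:R^-1) = 1 - n.+1%:R^-1 :> R.
  under eq_bigr do rewrite -opprB.
  by rewrite sumrN (telescope_sumr (fun p => p%:R^-1)) //= opprB invr1.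
by rewrite gerBl invr_ge0.
Qed.

(** * The totient ratio as an Euler product, and its large primes *)

Lemma big_mem_uniq (T : Type) (idx : T) (op : Monoid.com_law idx)
    (I : eqType) (r s : seq I) (F : I -> T) :
  uniq r -> uniq s -> {subset s <= r} ->
  \big[op/idx]_(i <- r | i \in s) F i = \big[op/idx]_(i <- s) F i.
Proof.
move=> ur us sr; rewrite -big_filter; apply/perm_big/uniq_perm => //.
  exact: filter_uniq.
by move=> i; rewrite mem_filter andb_idr //; apply: sr.
Qed.

Lemma totient_ratioE (R : realType) (n : nat) : (0 < n)%N ->
  totient_ratio R n = \prod_(p <- primes n) (p%:R / p.-1%:R).
Proof.
move=> n0; rewrite /totient_ratio totientE // {1}(prod_prime_decomp n0).
rewrite prime_decompE big_map /= !natr_prod -prodf_div big_seq [RHS]big_seq.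
apply: eq_bigr => p; rewrite mem_primes => /and3P[pp _ pn].
have lp : (0 < logn p n)%N by rewrite logn_gt0 mem_primes pp n0.
rewrite -{1}(prednK lp) /= expnS !natrM invfM.
have q0 : (p ^ (logn p n).-1)%:R != 0 :> R.
  by rewrite pnatr_eq0 -lt0n expn_gt0 prime_gt0.
by rewrite mulrACA divff // mulr1.
Qed.

Lemma prime_ratioE (R : realType) (p : nat) : prime p ->
  p%:R / p.-1%:R = 1 + p.-1%:R^-1 :> R.
Proof.
move=> /prime_gt1 p1; have q0 : p.-1%:R != 0 :> R by rewrite pnatr_eq0; lia.
rewrite -{1}(@prednK p) //; last by lia.
by rewrite -natr1 mulrDl divff // mul1r.
Qed.

Lemma prime_ratio_le (R : realType) (p : nat) : prime p ->
  p%:R / p.-1%:R <= expR p.-1%:R^-1 :> R.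
Proof. by move=> pp; rewrite prime_ratioE // expR_ge1Dx. Qed.

Lemma prime_ratio_ge1 (R : realType) (p : nat) : prime p ->
  1 <= p%:R / p.-1%:R :> R.
Proof. by move=> pp; rewrite prime_ratioE // lerDl invr_ge0. Qed.

Lemma inv_pred_prime_le (R : realType) (p : nat) : prime p ->
  p.-1%:R^-1 <= 2 * p%:R^-1 :> R.
Proof.
move=> /prime_gt1 p1; rewrite -[2]invrK -invfM.
rewrite lef_pV2 ?posrE ?ltr0n ?mulr_gt0 ?invr_gt0 ?ltr0n; [|lia..].
rewrite mulrC ler_pdivrMr // -natrM ler_nat; lia.
Qed.

Lemma sieve_level_ge2 (R : realType) (M : nat) (alpha : R) :
  2 <= sieve_level M alpha.
Proof. by rewrite /sieve_level le_max lexx orbT. Qed.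

(* Primes above [ln M] are controlled by [\sum_(p %| a) ln p <= ln M], and those
   between the level [(ln M) ^ alpha] and [ln M] by [1/p <= (ln p / p) / ln y]. *)
Lemma sum_inv_large_primes_le (R : realType) (alpha : R) (M a : nat) :
  0 < alpha -> (0 < a <= M)%N ->
  \sum_(p <- primes a | sieve_level M alpha < p%:R) p%:R^-1 <=
    (ln 2)^-1 + alpha^-1 + ln 4 / ln 2.
Proof.
move=> alpha0 /andP[a0 aM]; set y := sieve_level M alpha.
have M0 : (0 < M)%N by apply: leq_trans aM.
have l2 : 0 < ln 2 :> R by rewrite ln_gt0 // ltr1n.
have l4 : 0 < ln 4 :> R by rewrite ln_gt0 // ltr1n.
have il2 : 0 < (ln 2)^-1 :> R by rewrite invr_gt0.
have ia : 0 < alpha^-1 by rewrite invr_gt0.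
have rhs0 : 0 < ln 4 / ln 2 :> R by rewrite divr_gt0.
set X : R := ln M%:R.
have [X0|X0] := leP X 0.
  have a1 : a = 1%N.
    apply/eqP; rewrite eqn_leq a0 andbT leqNgt; apply/negP => a2.
    suff : 0 < X by rewrite ltNge X0.
    by rewrite ln_gt0 // ltr1n (leq_trans a2).
  rewrite a1 big_nil; lra.
have y2 : 2 <= y := sieve_level_ge2 M alpha.
have y0 : 0 < y by lra.
have lny2 : ln 2 <= ln y by rewrite ler_ln ?posrE.
have lny0 : 0 < ln y by lra.
have lnXy : ln X <= ln y / alpha.
  rewrite ler_pdivlMr // mulrC -ln_powR ler_ln ?posrE ?powR_gt0 //.
  by rewrite /y /sieve_level le_max lexx.
rewrite (bigID (fun p : nat => X < p%:R)) /= -addrA; apply: lerD.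
  (* Each [ln p] is at least [ln 2], and the sum of the [ln p] is at most [X], which leaves
     [(ln 2)^-1]. *)
  apply: (@le_trans _ _ (\sum_(p <- primes a) ln p%:R / (X * ln 2))).
    rewrite big_mkcond big_seq [leRHS]big_seq; apply: ler_sum => p.
    rewrite mem_primes => /and3P[pp _ _].
    have lp : ln 2 <= ln p%:R :> R by apply: ler_ln_nat => //; apply: prime_gt1.
    case: ifP => [/andP[_ Xp]|_]; last by rewrite divr_ge0 ?mulr_ge0; lra.
    apply: (@le_trans _ _ X^-1).
      by rewrite lef_pV2 ?posrE ?ltr0n ?prime_gt0 // ltW.
    by rewrite invfM mulrCA -[leLHS]mulr1 ler_pM2l ?invr_gt0 // ler_pdivlMr // mul1r.
  rewrite -mulr_suml ler_pdivrMr ?mulr_gt0 // mulrCA mulVf ?gt_eqF // mulr1.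
  apply: le_trans (ler_ln_nat R a0 aM); apply: sum_ln_primes_le => //.
    exact: primes_uniq.
  by move=> p; rewrite mem_primes => /and3P[-> _ ->].
have [T0|T0] := posnP (Num.trunc X).
  rewrite big_seq_cond big1; first by rewrite addr_ge0 ?ltW.
  move=> p /andP[]; rewrite mem_primes => /and3P[/prime_gt0 p0 _ _] /andP[_].
  rewrite -leNgt -truncn_ge_nat ?ltW // T0; lia.
have X1 : 1 <= X by rewrite -truncn_gt0.
(* The primes in [(y, X]] contribute at most [(ln X + ln 4) / ln y]; [lnXy] and [ln y >= ln 2] then
   give the last two constants. *)
apply: (@le_trans _ _ (\sum_(0 <= p < (Num.trunc X).+1 | prime p)
                         ln p%:R / p%:R / ln y)).
  rewrite -big_filter.
  rewrite -(@big_mem_uniq _ _ _ _ (index_iota 0 (Num.trunc X).+1)) ?iota_uniq //; first 1 last.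
  - by rewrite filter_uniq ?primes_uniq.
  - move=> p; rewrite mem_filter -leNgt mem_index_iota ltnS => /andP[/andP[_ pX] _].
    by rewrite leq0n truncn_ge_nat ?(ltW X0).
  rewrite /= [leLHS]big_mkcond [leRHS]big_mkcond; apply: ler_sum => p _.
  rewrite mem_filter mem_primes; case: (boolP (prime p)) => [pp|] /=; last by rewrite andbF.
  have p0 : 0 < p%:R :> R by rewrite ltr0n prime_gt0.
  case: ifP => [/andP[/andP[yp _] _]|_].
    rewrite mulrAC -[leLHS]mul1r ler_pM2r ?invr_gt0 // ler_pdivlMr // mul1r.
    by rewrite ler_ln ?posrE // ltW.
  by rewrite !divr_ge0 ?ltW // ln_gt0 // ltr1n prime_gt1.
rewrite -mulr_suml ler_pdivrMr //; apply: le_trans (sum_ln_primes_div_le R T0) _.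
rewrite mulrDl; apply: lerD.
  rewrite mulrC; apply: le_trans lnXy; rewrite ler_ln ?posrE ?ltr0n //.
  by rewrite truncn_le ltW.
by rewrite mulrAC ler_pdivlMr // ler_pM2l.
Qed.

Lemma prod_large_prime_ratios_le (R : realType) (alpha : R) (M a : nat) :
  0 < alpha -> (0 < a <= M)%N ->
  \prod_(p <- primes a | sieve_level M alpha < p%:R) (p%:R / p.-1%:R) <=
    expR (2 * ((ln 2)^-1 + alpha^-1 + ln 4 / ln 2)).
Proof.
move=> alpha0 aM.
apply: (@le_trans _ _
  (expR (\sum_(p <- primes a | sieve_level M alpha < p%:R) 2 * p%:R^-1))).
  rewrite expR_sum big_seq_cond [leRHS]big_seq_cond.
  apply: ler_prod => p /andP[]; rewrite mem_primes => /andP[pp _] _.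
  rewrite divr_ge0 //= (le_trans (prime_ratio_le R pp)) // ler_expR.
  exact: inv_pred_prime_le.
by rewrite ler_expR -mulr_sumr ler_pM2l // sum_inv_large_primes_le.
Qed.

(** * Expansion over the sieve support *)

Lemma sieve_support_mul_prime (R : realType) (y : R) (d q : nat) :
  sieve_support y d -> prime q -> q%:R <= y -> coprime d q ->
  sieve_support y (d * q).
Proof.
move=> [[d0 dsq] dy] pq qy cdq; split; last first.
  move=> p pp; rewrite Euclid_dvdM // => /orP[|]; first exact: dy.
  by rewrite dvdn_prime2 // => /eqP ->; rewrite ltr1n prime_gt1.
split; first by rewrite muln_gt0 d0 prime_gt0.
move=> e e2; have [e1|e1] := leqP e 1.
  by case: e e2 e1 => [|[|//]] //; rewrite dvd0n muln_eq0 !eqn0Ngt d0 prime_gt0.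
(* The least prime factor of [e] suffices: its square divides [d * q], so either it is [q], which
   then divides [d], or its square divides [d]. Both are impossible. *)
have pr := pdiv_prime e1; have re := pdiv_dvd e.
have r2 : (pdiv e ^ 2 %| d * q)%N by apply: dvdn_trans e2; apply: dvdn_exp2r.
have [rq|rq] := eqVneq (pdiv e) q.
  move: r2; rewrite rq expnS expn1 dvdn_pmul2r ?prime_gt0 // => qd.
  by move: cdq; rewrite coprime_sym prime_coprime // qd.
have : (pdiv e ^ 2 %| d)%N.
  rewrite -(@Gauss_dvdl _ _ q) // coprime_pexpl // prime_coprime //.
  by rewrite dvdn_prime2.
by move/dsq => r1; rewrite r1 in pr.
Qed.

(* Expanding the product over [ps] one prime at a time keeps the divisor [d]
   inside the sieve support. *)
Lemma sum_prod_dvd_le (R : realType) (N : nat) (a : 'I_N -> nat)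
    (g f : nat -> R) (gamma y : R) :
  multiplicative_function g ->
  (forall n, sieve_support y n -> (omega a n)%:R <= gamma * N%:R / g n) ->
  (forall p, prime p -> 0 <= f p) ->
  forall (ps : seq nat) (d : nat), uniq ps ->
  {in ps, forall p, [&& prime p, p%:R <= y & coprime d p]} ->
  sieve_support y d ->
  \sum_(n < N | (d %| a n)%N)
      \prod_(p <- ps) (1 + (if (p %| a n)%N then f p else 0)) <=
    gamma * N%:R / g d * \prod_(p <- ps) (1 + f p / g p).
Proof.
move=> [g1 gM] hom f0; elim=> [|q ps IHps] d /=.
  move=> _ _ dD; rewrite big_nil mulr1.
  under eq_bigr do rewrite big_nil.
  by rewrite sumr_const; apply: le_trans (hom d dD); rewrite /omega cardsE.
move=> /andP[qps ups] psP dD.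
have /and3P[pq qy cdq] := psP q (mem_head _ _).
have psP' p : p \in ps -> [&& prime p, p%:R <= y & coprime d p].
  by move=> pps; apply: psP; rewrite inE pps orbT.
have d0 : (0 < d)%N by case: dD => -[].
(* The summand 1 leaves [d] in place; the summand [f q] restricts to multiples of [q], so that [d]
   becomes [d * q]. *)
under eq_bigr do rewrite big_cons mulrDl mul1r.
rewrite big_split big_cons /= mulrDl mul1r mulrDr; apply: lerD.
  exact: IHps.
rewrite (eq_bigr (fun n => if (q %| a n)%N then
    f q * \prod_(p <- ps) (1 + (if (p %| a n)%N then f p else 0)) else 0));
  last by move=> n _; case: ifP; rewrite ?mul0r.
rewrite -big_mkcondr -mulr_sumr /=.
under eq_bigl do rewrite -Gauss_dvd //.
have := IHps (d * q)%N ups _ (sieve_support_mul_prime dD pq qy cdq).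
have psdq : {in ps, forall p, [&& prime p, p%:R <= y & coprime (d * q) p]}.
  move=> p pps; have /and3P[pp -> cdp] := psP' p pps.
  rewrite pp coprimeMl cdp /= prime_coprime // dvdn_prime2 //.
  by apply: contra qps => /eqP ->.
move=> /(_ psdq) /(ler_wpM2l (f0 q pq)) /le_trans -> //.
rewrite (gM d q d0 (prime_gt0 pq) cdq) invfM le_eqVlt; apply/orP; left; apply/eqP; ring.
Qed.

(** * Bounds for the local factors *)

(** Put [F = (p / (p - 1)) ^ s]. For [p <= s], [F >= 1] bounds the left side by [(1 + 1 / c0) F].
    For [p > s], [v = s / (p - 1)] is at most 1, so [F - 1 <= e v], and [1 / (p - 1) <= 2 / p]
    yields the constant [2 e]. *)
Lemma local_factor_le (R : realType) (c0 x : R) (s p : nat) :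
  0 < c0 -> c0 <= x -> prime p ->
  1 + ((p%:R / p.-1%:R) ^+ s - 1) / x <=
    expR (2 * expR 1 * s%:R * (p%:R * x)^-1
          + (if (p <= s)%N then c0^-1 + s%:R * p.-1%:R^-1 else 0)).
Proof.
move=> c00 c0x pp; have x0 : 0 < x by apply: lt_le_trans c0x.
have p1 := prime_gt1 pp.
have p0 : 0 < p%:R :> R by rewrite ltr0n; lia.
set F := (p%:R / p.-1%:R) ^+ s; set u : R := p.-1%:R^-1.
have F1 : 1 <= F by apply: exprn_ege1; apply: prime_ratio_ge1.
have FE : F <= expR (s%:R * u).
  rewrite expRM_natl lerXn2r ?nnegrE ?expR_ge0 ?divr_ge0 //.
  exact: prime_ratio_le.
have s0 : 0 <= s%:R :> R by [].
have main0 : 0 <= 2 * expR 1 * s%:R * (p%:R * x)^-1.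
  by rewrite !mulr_ge0 ?expR_ge0 // invr_ge0 mulr_ge0 ?ltW.
case: ifP => [_|/negbT]; rewrite ?addr0.
  apply: (@le_trans _ _ (expR (c0^-1 + s%:R * u))); last by rewrite ler_expR lerDr.
  have i0 : 0 < c0^-1 by rewrite invr_gt0.
  have h1 : (F - 1) / x <= (F - 1) / c0.
    by rewrite ler_wpM2l ?subr_ge0 // lef_pV2.
  have h2 : (1 + c0^-1) * F <= expR c0^-1 * expR (s%:R * u).
    by apply: ler_pM; rewrite ?expR_ge1Dx //; lra.
  rewrite expRD; apply: le_trans h2; nra.
rewrite -ltnNge => sp.
have su1 : s%:R * u <= 1.
  by rewrite ler_pdivrMr ?ltr0n ?mul1r ?ler_nat; lia.
have su0 : 0 <= s%:R * u by rewrite mulr_ge0 // invr_ge0.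
have h1 : F - 1 <= s%:R * u * expR 1.
  have E1 : expR (s%:R * u) <= expR 1 by rewrite ler_expR.
  (* With [v = s * u], multiplying [1 - v <= exp (- v)] by [exp v] gives [exp v - 1 <= v exp v]. *)
  have := expR_ge1Dx (- (s%:R * u)); rewrite expRN => h.
  have := ler_wpM2l (expR_ge0 (s%:R * u)) h; rewrite divff ?expR_eq0 //.
  move: su0 E1 FE; nra.
apply: le_trans (expR_ge1Dx _); rewrite lerD2l invfM mulrA.
rewrite ler_pM2r ?invr_gt0 //; apply: le_trans h1 _.
have := inv_pred_prime_le R pp => /(ler_wpM2l s0) /(ler_wpM2r (expR_ge0 1)).
by rewrite /u; move/le_trans; apply; rewrite le_eqVlt; apply/orP; left; apply/eqP; ring.
Qed.

(** [Y] may lie on either side of [s], so the right-hand range is widened to [maxn Y s.+1] and then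
    cut at [Y]. *)
Lemma ler_sum_nat_upto (R : realType) (P : pred nat) (F : nat -> R) (Y s : nat) :
  (forall p, 0 <= F p) ->
  \sum_(0 <= p < Y | P p) (if (p <= s)%N then F p else 0) <=
    \sum_(0 <= p < s.+1 | P p) F p.
Proof.
move=> F0; rewrite -big_mkcondr /=.
rewrite [leRHS](@big_nat_widen _ _ _ _ _ (maxn Y s.+1)) ?leq_maxr //.
by rewrite [leRHS](@big_cat_nat _ _ _ Y) ?leq_maxl //= lerDl sumr_ge0.
Qed.

Lemma sum_primes_const_le (R : realType) (c : R) (s : nat) :
  0 <= c -> \sum_(0 <= p < s.+1 | prime p) c <= s%:R * c.
Proof.
move=> c0; rewrite big_mkcond big_ltn //= add0r.
have <- : \sum_(1 <= p < s.+1) c = s%:R * c.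
  by rewrite sumr_const_nat subn1 mulr_natl.
by apply: ler_sum => p _; case: ifP.
Qed.

Lemma sum_primes_le_series (R : realType) (u : nat -> R) (L : R) (Y : nat) :
  (forall p, prime p -> 0 <= u p) ->
  (\sum_(0 <= p <oo | prime p) (u p)%:E)%E = L%:E ->
  \sum_(0 <= p < Y | prime p) u p <= L.
Proof.
move=> u0 uL; rewrite -lee_fin -uL -sumEFin; apply: nneseries_lim_ge => p _ pp.
by rewrite lee_fin u0.
Qed.

(** The bound is uniform in [Y]: the series controls the terms [1 / (p g(p))], and the primes up to
    [s] bring at most [s / c0] plus [s] times Mertens' bound. *)
Lemma prod_local_factors_le (R : realType) (L c0 : R) (g : nat -> R) (s Y : nat) :
  0 < c0 -> (0 < s)%N -> (forall p, prime p -> c0 <= g p) ->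
  (\sum_(0 <= p <oo | prime p) ((p%:R * g p)^-1)%:E)%E = L%:E ->
  \prod_(0 <= p < Y | prime p) (1 + ((p%:R / p.-1%:R) ^+ s - 1) / g p) <=
    expR (s%:R * ln (ln (s%:R + 2)) +
      (2 * expR 1 * `|L| + c0^-1 + (2 - ln (ln 2) + ln 4 / ln 2)) * s%:R).
Proof.
move=> c00 s0 gc0 gL.
have s0' : 0 < s%:R :> R by rewrite ltr0n.
apply: (@le_trans _ _ (\prod_(0 <= p < Y | prime p)
  expR (2 * expR 1 * s%:R * (p%:R * g p)^-1
        + (if (p <= s)%N then c0^-1 + s%:R * p.-1%:R^-1 else 0)))).
  apply: ler_prod => p pp; have gp := gc0 p pp.
  rewrite (local_factor_le s c00 gp pp) andbT addr_ge0 // divr_ge0 //.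
    by rewrite subr_ge0 exprn_ege1 // prime_ratio_ge1.
  exact: ltW (lt_le_trans c00 gp).
rewrite -expR_sum ler_expR big_split /= -mulr_sumr.
have hL : \sum_(0 <= p < Y | prime p) (p%:R * g p)^-1 <= `|L|.
  apply: le_trans (ler_norm _); apply: sum_primes_le_series gL => p pp.
  by rewrite invr_ge0 mulr_ge0 // ltW // (lt_le_trans c00) // gc0.
have e0 : 0 <= 2 * expR 1 * s%:R :> R by rewrite !mulr_ge0 ?expR_ge0.
have {}hL := ler_wpM2l e0 hL.
have h2 : \sum_(0 <= p < Y | prime p)
    (if (p <= s)%N then c0^-1 + s%:R * p.-1%:R^-1 else 0) <=
    s%:R * c0^-1 + s%:R * (ln (ln s.+1%:R) + (2 - ln (ln 2) + ln 4 / ln 2)).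
  apply: le_trans (ler_sum_nat_upto _ _ _ _) _.
    by move=> p; rewrite addr_ge0 ?mulr_ge0 ?invr_ge0 // ltW.
  rewrite big_split /= lerD ?sum_primes_const_le ?invr_ge0 ?(ltW c00) //.
  by rewrite -mulr_sumr ler_pM2l // sum_inv_pred_primes_le.
have h3 : s%:R * ln (ln s.+1%:R) <= s%:R * ln (ln (s%:R + 2)) :> R.
  have e2 : s%:R + 2 = s.+2%:R :> R by rewrite -natrD addn2.
  rewrite ler_pM2l // ler_ln ?posrE ?ln_gt0 ?e2 ?ltr1n //; exact: ler_ln_nat.
apply: le_trans (lerD hL h2) _; lra.
Qed.

(** * Moments and the tail estimate *)

(** The expansion is used with [d = 1] and all primes up to [y]: a prime dividing [a n] gives
    [1 + f p], the [s]-th power of its ratio, and any other prime gives 1. *)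
Lemma sum_sifted_ratio_le (R : realType) (N : nat) (a : 'I_N -> nat)
    (g : nat -> R) (gamma y : R) (s : nat) :
  0 <= y -> (forall n, (0 < a n)%N) -> multiplicative_function g ->
  (forall n, sieve_support y n -> (omega a n)%:R <= gamma * N%:R / g n) ->
  \sum_(n < N) (\prod_(p <- primes (a n) | ~~ (y < p%:R)) (p%:R / p.-1%:R)) ^+ s
    <= gamma * N%:R * \prod_(0 <= p < (Num.trunc y).+1 | prime p)
                         (1 + ((p%:R / p.-1%:R) ^+ s - 1) / g p).
Proof.
move=> y0 a0 gM hom; set Y := (Num.trunc y).+1.
pose ps := [seq p <- index_iota 0 Y | prime p].
pose f (p : nat) : R := (p%:R / p.-1%:R) ^+ s - 1.
have D1 : sieve_support y 1.
  split; first by split => // d; rewrite dvdn1 -[1%N]/(1 ^ 2)%N eqn_exp2r // => /eqP.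
  by move=> p pp; rewrite dvdn1 => /eqP p1; rewrite p1 in pp.
have f0 p : prime p -> 0 <= f p.
  by move=> pp; rewrite subr_ge0 exprn_ege1 // prime_ratio_ge1.
have psP : {in ps, forall p, [&& prime p, p%:R <= y & coprime 1 p]}.
  move=> p; rewrite mem_filter mem_index_iota ltnS => /andP[-> /andP[_]].
  by rewrite truncn_ge_nat // coprime1n => ->.
have ups : uniq ps by rewrite filter_uniq // iota_uniq.
have := sum_prod_dvd_le gM hom f0 ups psP D1.
have -> : g 1%N = 1 by case: gM.
rewrite divr1 big_filter; apply: le_trans; rewrite le_eqVlt; apply/orP; left; apply/eqP.
apply: eq_big => [n|n _]; first by rewrite dvd1n.
rewrite -prodrXl -big_filter -(@big_mem_uniq _ _ _ _ ps) //; first last.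
- move=> p; rewrite !mem_filter -leNgt mem_primes mem_index_iota ltnS.
  by move=> /andP[py /andP[-> _]]; rewrite leq0n truncn_ge_nat.
- by rewrite filter_uniq // primes_uniq.
rewrite /= big_mkcond big_seq [RHS]big_seq; apply: eq_bigr => p pps.
have /and3P[pp py _] := psP p pps.
rewrite mem_filter -leNgt py mem_primes pp a0 /= /f.
by case: ifP; rewrite ?addr0 // addrC subrK.
Qed.

(** In the constant, [gamma] absorbs the prefactor, the next summand pays for the primes above the
    sieve level, and the last group for the local factors. *)
Lemma moment_le (R : realType) (gamma L c0 alpha : R) (N M : nat)
    (a : 'I_N -> nat) (g : nat -> R) (s : nat) :
  0 < gamma -> 0 < c0 -> 0 < alpha ->
  (forall n : 'I_N, (0 < a n <= M)%N) ->
  multiplicative_function g ->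
  (forall n : nat, sieve_support (sieve_level M alpha) n ->
     (omega a n)%:R <= gamma * N%:R / g n) ->
  (forall p : nat, prime p -> c0 <= g p) ->
  (\sum_(0 <= p <oo | prime p) ((p%:R * g p)^-1)%:E)%E = L%:E ->
  \sum_(n < N) (totient_ratio R (a n)) ^+ s <=
    expR (s%:R * ln (ln (s%:R + 2)) +
      (gamma + 2 * ((ln 2)^-1 + alpha^-1 + ln 4 / ln 2)
       + (2 * expR 1 * `|L| + c0^-1 + (2 - ln (ln 2) + ln 4 / ln 2))) * s%:R)
    * N%:R.
Proof.
move=> gamma0 c00 alpha0 aM gM hom gc0 gL.
(* For [s = 0] both sides equal [N]; the bound [gamma <= exp (gamma s)] below uses [s >= 1]. *)
have [->|s0] := posnP s.
  under eq_bigr do rewrite expr0.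
  by rewrite sumr_const card_ord !(mul0r, mulr0) addr0 expR0 mul1r.
have a0 n : (0 < a n)%N by have /andP[] := aM n.
set y := sieve_level M alpha in hom.
have y0 : 0 <= y by apply: le_trans (sieve_level_ge2 M alpha).
set K := 2 * (_ + _ + _).
set C1 := 2 * expR 1 * _ + _ + _.
apply: (@le_trans _ _ (expR (s%:R * K) * \sum_(n < N)
  (\prod_(p <- primes (a n) | ~~ (y < p%:R)) (p%:R / p.-1%:R)) ^+ s)).
  rewrite mulr_sumr; apply: ler_sum => n _.
  rewrite totient_ratioE // (bigID (fun p : nat => y < p%:R)) /= exprMn.
  have prod0 (P : pred nat) : 0 <= \prod_(p <- primes (a n) | P p) (p%:R / p.-1%:R) :> R.
    by apply: prodr_ge0 => p _; rewrite divr_ge0.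
  rewrite ler_wpM2r ?exprn_ge0 // expRM_natl lerXn2r ?nnegrE ?expR_ge0 //.
  exact: prod_large_prime_ratios_le.
have := sum_sifted_ratio_le s y0 a0 gM hom.
move=> /(ler_wpM2l (expR_ge0 (s%:R * K))) /le_trans; apply.
have := prod_local_factors_le (Num.trunc y).+1 c00 s0 gc0 gL.
have gN : 0 <= gamma * N%:R by rewrite mulr_ge0 // ltW.
move=> /(ler_wpM2l gN) /(ler_wpM2l (expR_ge0 (s%:R * K))) /le_trans; apply.
rewrite -/C1; set B := s%:R * ln _.
have gs : gamma <= expR (gamma * s%:R).
  apply: (@le_trans _ _ (gamma * s%:R)).
    by rewrite ler_peMr ?(ltW gamma0) // ler1n.
  by apply: le_trans (expR_ge1Dx _); rewrite lerDr.
rewrite (_ : B + (gamma + K + C1) * s%:R = s%:R * K + (gamma * s%:R + (B + C1 * s%:R))); last by ring.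
rewrite (expRD (s%:R * K)) (expRD (gamma * s%:R)) -!mulrA ler_pM2l ?expR_gt0 //.
by rewrite (mulrC N%:R) ler_wpM2r // mulr_ge0 ?expR_ge0.
Qed.

(* Markov's inequality for the moment of order [s], where [s + 2] is the integer
   part of [expR (c2 * t)]. *)
Lemma tail_of_moments (R : realType) (N : nat) (x : 'I_N -> R) (C : R) :
  (forall n, 0 <= x n) ->
  (forall s : nat, \sum_(n < N) x n ^+ s <=
     expR (s%:R * ln (ln (s%:R + 2)) + C * s%:R) * N%:R) ->
  forall t, 0 < t ->
  (#|[set n : 'I_N | (t < x n)%R]|)%:R <=
    expR 3 * expR (- expR (expR (- (C + 1)) * t)) * N%:R.
Proof.
move=> x0 hx t t0; set c2 := expR (- (C + 1)); set E := expR (c2 * t).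
have E0 : 0 <= E := expR_ge0 _.
have /andP[TE ET] := truncn_itv E0; rewrite -natr1 in ET.
rewrite -expRD.
(* Here [E < 3], so the right-hand side is at least [N]. *)
have [T2|T2] := leqP (Num.trunc E) 2.
  apply: (@le_trans _ _ N%:R); first by rewrite ler_nat -[leqRHS]card_ord max_card.
  rewrite -[leLHS]mul1r ler_wpM2r //; apply: le_trans (expR_ge1Dx _); rewrite lerDl.
  have : (Num.trunc E)%:R <= 2 :> R by rewrite ler_nat.
  lra.
pose s := (Num.trunc E - 2)%N.
have sT : s%:R + 2 = (Num.trunc E)%:R :> R by rewrite -natrD; congr _%:R; rewrite /s; lia.
have s0 : 0 < s%:R :> R by rewrite ltr0n /s; lia.
have ls0 : 0 < ln (s%:R + 2) :> R by rewrite ln_gt0 //; lra.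
have lst : ln (s%:R + 2) <= c2 * t.
  by rewrite -(expRK (c2 * t)) ler_ln ?posrE ?expR_gt0 ?sT //; lra.
set k := #|_|.
have markov : k%:R * t ^+ s <= \sum_(n < N) x n ^+ s.
  rewrite mulr_natl -sumr_const big_mkcond /=; apply: ler_sum => n _.
  rewrite inE; case: ifP => [tx|_]; last exact: exprn_ge0.
  by rewrite lerXn2r ?nnegrE ?ltW // (lt_trans t0).
(* The choice of [c2] acts here: [ln (s + 2) <= c2 t] and [ln c2 = - (C + 1)] bound the exponent by
   [s ln t - s]. *)
have bound : expR (s%:R * ln (ln (s%:R + 2)) + C * s%:R) <= expR (- s%:R) * t ^+ s.
  rewrite -[X in X ^+ s](@lnK _ t) ?posrE // -expRM_natl -expRD ler_expR.
  have : ln (ln (s%:R + 2)) <= ln (c2 * t).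
    by rewrite ler_ln ?posrE // mulr_gt0 ?expR_gt0.
  rewrite lnM ?posrE ?expR_gt0 // /c2 expRK => /(ler_wpM2l (ltW s0)); lra.
have : k%:R * t ^+ s <= expR (- s%:R) * N%:R * t ^+ s.
  apply: le_trans markov _; apply: le_trans (hx s) _.
  by rewrite mulrAC ler_wpM2r.
rewrite ler_pM2r ?exprn_gt0 // => /le_trans; apply.
rewrite ler_wpM2r ?ler0n // ler_expR.
(* Truncation loses less than 1, so [- s <= 3 - E]; this is the source of the factor [exp 3]. *)
have {}ET : E < s%:R + 2 + 1 by rewrite sT.
rewrite lerNl opprB lerBlDr (le_trans (ltW ET)) // -addrA lerD2l.
by rewrite -(natrD _ 2 1).
Qed.

Theorem theorem1p2 (R : realType) (gamma L c0 alpha : R)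
    (hgamma : 0 < gamma) (hc0 : 0 < c0)
    (halpha0 : 0 < alpha) (halpha1 : alpha <= 1) :
  exists C c1 c2 : R, [/\ 0 < C, 0 < c1, 0 < c2 &
    forall (N M : nat) (a : 'I_N -> nat) (g : nat -> R),
      (0 < N)%N -> (0 < M)%N ->
      (forall n : 'I_N, (0 < a n <= M)%N) ->
      multiplicative_function g ->
      (forall n : nat, sieve_support (sieve_level M alpha) n ->
         (omega a n)%:R <= gamma * N%:R / g n) ->
      (forall p : nat, prime p -> c0 <= g p) ->
      (\sum_(0 <= p <oo | prime p) ((p%:R * g p)^-1)%:E)%E = L%:E ->
      (forall s : nat,
         \sum_(n < N) (totient_ratio R (a n)) ^+ s
           <= expR (s%:R * ln (ln (s%:R + 2)) + C * s%:R) * N%:R)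
      /\
      (forall t : R, 0 < t ->
         (#|[set n : 'I_N | (t < totient_ratio R (a n))%R]|)%:R
           <= c1 * expR (- expR (c2 * t)) * N%:R)].
Proof.
(* The constants are chosen while [L] is still an arbitrary real, not yet the sum of a series; [|L|]
   secures [C > 0]. *)
pose C : R := gamma + 2 * ((ln 2)^-1 + alpha^-1 + ln 4 / ln 2)
  + (2 * expR 1 * `|L| + c0^-1 + (2 - ln (ln 2) + ln 4 / ln 2)).
exists C, (expR 3), (expR (- (C + 1))); split; rewrite ?expR_gt0 //.
  have l2 : 0 < ln 2 :> R by rewrite ln_gt0 // ltr1n.
  have l4 : 0 < ln 4 :> R by rewrite ln_gt0 // ltr1n.
  have q0 : 0 < ln 4 / ln 2 :> R by rewrite divr_gt0.
  have L0 : 0 <= 2 * expR 1 * `|L| by rewrite !mulr_ge0 ?expR_ge0.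
  have ll2 : ln (ln 2) <= 0 :> R.
    have ->: 2 = 1 + 1 :> R by [].
    by rewrite ln_le0 // le_ln1Dx // ltrN10.
  have i1 : 0 < (ln 2)^-1 :> R by rewrite invr_gt0.
  have i2 : 0 < alpha^-1 by rewrite invr_gt0.
  have i3 : 0 < c0^-1 by rewrite invr_gt0.
  rewrite /C; lra.
move=> N M a g _ _ aM gM hom gc0 gL.
have mom s := moment_le s hgamma hc0 halpha0 aM gM hom gc0 gL.
by split=> [//|t t0]; apply: tail_of_moments => // n; rewrite divr_ge0.
Qed.
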